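(* Let $\mathcal{A}\in\mathrm{S}(m,2)$ with $\mathrm{rank}(\mathcal{A})=2$. If $\mathcal{A}$ is a $\mathrm{Q}$-tensor, then $\mathcal{A}$ is an $\mathrm{R}_0$-tensor.
   Context: $[n]=\{1,\dots,n\}$. $\mathrm{T}(m,n)$ is the set of all real tensors $\mathcal{A}=(a_{i_1 i_2\dots i_m})$, $i_1,\dots,i_m\in[n]$, of order $m$ and dimension $n$; $\mathrm{S}(m,n)\subset\mathrm{T}(m,n)$ is the set of symmetric tensors, i.e. those whose entries are invariant under any permutation of the indices. For $\mathbf{u}\in\mathbb{R}^n$, $\mathcal{A}\mathbf{u}^{m-1}\in\mathbb{R}^n$ is the vector with components $(\mathcal{A}\mathbf{u}^{m-1})_i=\sum_{i_2,\dots,i_m=1}^n a_{i i_2\dots i_m}u_{i_2}\cdots u_{i_m}$. For a vector $\mathbf{x}$, $\mathbf{x}\ge\mathbf{0}$ means every component is nonnegative. For $\mathbf{q}\in\mathbb{R}^n$, the tensor complementarity problem $\mathrm{TCP}(\mathcal{A},\mathbf{q})$ is to find $\mathbf{u}\in\mathbb{R}^n$ with $\mathbf{u}\ge\mathbf{0}$, $\mathcal{A}\mathbf{u}^{m-1}+\mathbf{q}\ge\mathbf{0}$ and $\mathbf{u}^T(\mathcal{A}\mathbf{u}^{m-1}+\mathbf{q})=0$; such a $\mathbf{u}$ is called a solution. $\mathcal{A}$ is a $\mathrm{Q}$-tensor if $\mathrm{TCP}(\mathcal{A},\mathbf{q})$ has a solution for every $\mathbf{q}\in\mathbb{R}^n$.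 $\mathcal{A}$ is an $\mathrm{R}_0$-tensor if $\mathbf{0}$ is the only solution of $\mathrm{TCP}(\mathcal{A},\mathbf{0})$. A tensor in $\mathrm{T}(m,n)$ is a rank one tensor if it equals $\mathbf{x}^{(1)}\otimes\mathbf{x}^{(2)}\otimes\cdots\otimes\mathbf{x}^{(m)}$ (the tensor with entries $x^{(1)}_{i_1}x^{(2)}_{i_2}\cdots x^{(m)}_{i_m}$) for some non-zero vectors $\mathbf{x}^{(1)},\dots,\mathbf{x}^{(m)}\in\mathbb{R}^n$. The rank of $\mathcal{A}\in\mathrm{T}(m,n)$, denoted $\mathrm{rank}(\mathcal{A})$, is the minimum number of rank one tensors (not required to be symmetric) needed to write $\mathcal{A}$ as a real linear combination of rank one tensors. *)

(* Defs.v *)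
(* MathComp world; the real numbers are an arbitrary [R : realType]. *)
From HB Require Import structures.
From mathcomp Require Import all_boot all_order all_algebra all_fingroup.
From mathcomp Require Import reals.

Set Implicit Arguments.
Unset Strict Implicit.
Unset Printing Implicit Defensive.

Import Order.TTheory GRing.Theory Num.Theory.
Local Open Scope ring_scope.

Definition tensor (R : realType) (m n : nat) : Type :=
  {ffun m.-tuple 'I_n -> R}.

Definition symmetric_tensor (R : realType) (m n : nat) (A : tensor R m n)
  : Prop :=
  forall (s : 'S_m) (t : m.-tuple 'I_n), A [tuple tnth t (s j) | j < m] = A t.

(* A u^(order - 1); the order is written m.+1 so that a multi-index splits
   into its first index and the remaining m ones. *)
Definition tensor_apply (R : realType) (m n : nat) (A : tensor R m.+1 n)
  (u : 'cV[R]_n) : 'cV[R]_n :=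
  \col_i \sum_(t : m.-tuple 'I_n)
    A [tuple of i :: t] * \prod_(j < m) u (tnth t j) 0.

Definition nonneg_vec (R : realType) (n : nat) (x : 'cV[R]_n) : Prop :=
  forall i, 0 <= x i 0.

Definition TCP_solution (R : realType) (m n : nat) (A : tensor R m.+1 n)
  (q u : 'cV[R]_n) : Prop :=
  [/\ nonneg_vec u,
      nonneg_vec (tensor_apply A u + q)
    & u^T *m (tensor_apply A u + q) = 0].

Definition Q_tensor (R : realType) (m n : nat) (A : tensor R m.+1 n) : Prop :=
  forall q : 'cV[R]_n, exists u : 'cV[R]_n, TCP_solution A q u.

Definition R0_tensor (R : realType) (m n : nat) (A : tensor R m.+1 n) : Prop :=
  forall u : 'cV[R]_n, TCP_solution A 0 u <-> u = 0.

Definition outer_product (R : realType) (m n : nat) (x : 'I_m -> 'cV[R]_n)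
  : tensor R m n :=
  [ffun t : m.-tuple 'I_n => \prod_(j < m) x j (tnth t j) 0].

Definition rank_one_tensor (R : realType) (m n : nat) (T : tensor R m n)
  : Prop :=
  exists x : 'I_m -> 'cV[R]_n, (forall j, x j != 0) /\ T = outer_product x.

Definition rank_one_combination (R : realType) (m n : nat) (A : tensor R m n)
  (r : nat) : Prop :=
  exists (c : 'I_r -> R) (T : 'I_r -> tensor R m n),
    (forall k, rank_one_tensor (T k)) /\
    A = [ffun t : m.-tuple 'I_n => \sum_(k < r) c k * T k t].

(* "rank A = r" as a relation: r is the least length of a rank one
   combination. *)
Definition has_tensor_rank (R : realType) (m n : nat) (A : tensor R m n)
  (r : nat) : Prop :=
  rank_one_combination A r /\
  forall r' : nat, rank_one_combination A r' -> (r <= r')%N.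

(* Main.v *)
(* If all but one slot of the two rank one terms x and y of A were parallel,
   A would have rank at most 1.  For order at least 3, symmetry in two slots then
   forces all the x_j to be parallel and all the y_j to be parallel, so that
   A = a p^(m+1) + b q^(m+1) with p, q independent.  A nonzero solution of
   TCP(A, 0) must lie on a coordinate axis, say the i-th, and this makes A u^m
   a difference of powers
     (A u^m)_i = a ((u_i + s u_j)^m - (u_i + t u_j)^m),
     (A u^m)_j = a (s (u_i + s u_j)^m - t (u_i + t u_j)^m),  a (s - t) > 0,
   for which TCP(A, q) is unsolvable for an explicit q.  Order 2 reduces to the
   same form by completing squares; a tensor of order 1 is never Q. *)
Require Import Defs.
From HB Require Import structures.
From mathcomp Require Import all_boot all_order all_algebra all_fingroup.
From mathcomp Require Import reals.
From mathcomp Require Import ring lra.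

Set Implicit Arguments.
Unset Strict Implicit.
Unset Printing Implicit Defensive.

Import Order.TTheory GRing.Theory Num.Theory.
Local Open Scope ring_scope.

(** * An unsolvable planar complementarity problem *)

(* (q1, q2) is (-1, 1 + |s|) for m even, where g >= s f; for m odd it is
   (-1, 1) if |t| <= s, where g >= 0, and (1, -1) otherwise, where f >= 0. *)
Lemma planar_unsolvable (R : realFieldType) (m : nat) (a s t : R)
    (f := fun v w => a * ((v + s * w) ^+ m - (v + t * w) ^+ m))
    (g := fun v w => a * (s * (v + s * w) ^+ m - t * (v + t * w) ^+ m)) :
  0 < a -> t < s ->
  exists q1 q2 : R, forall v w, 0 <= v -> 0 <= w ->
    0 <= f v w + q1 -> 0 <= g v w + q2 ->
    v * (f v w + q1) = 0 -> w * (g v w + q2) = 0 -> False.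
Proof.
move=> a0 ts.
have fw0 v : f v 0 = 0 by rewrite /f !mulr0 subrr mulr0.
have normX (x y : R) k : `|x| <= y -> `|x| ^+ k <= y ^+ k.
  by move=> xy; rewrite lerXn2r ?nnegrE ?(le_trans _ xy).
case: (boolP (odd m)) => [om|em]; last first.
  have eX (x : R) : x ^+ m = `|x| ^+ m.
    by rewrite -normrX ger0_norm ?exprn_even_ge0.
  exists (-1), (1 + `|s|) => v w v0 w0 f1 g1 /eqP fv /eqP gw.
  have wN0 : w != 0 by apply/eqP => w_0; move: f1; rewrite w_0 fw0; lra.
  move: gw; rewrite mulf_eq0 (negbTE wN0) /= => /eqP gw.
  have ls := ler_norm (- s); rewrite normrN in ls.
  have ns := normr_ge0 s.
  (* If [v] is nonzero, then [f v w = 1] and this bound gives [g v w >= s], against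
     [g v w = - (1 + |s|)]. *)
  have gf : s * f v w <= g v w.
    rewrite -subr_ge0 (_ : _ - _ = a * (s - t) * (v + t * w) ^+ m).
      by apply: mulr_ge0; [apply: mulr_ge0; lra | apply: exprn_even_ge0].
    by rewrite /f /g; ring.
  move: fv; rewrite mulf_eq0 => /orP[/eqP v_0|/eqP fv]; last first.
    have f_1 : f v w = 1 by lra.
    by move: gf; rewrite f_1; lra.
  (* Now [v = 0] and [f v w >= 1]. For [s >= 0] the bound makes [g v w] nonnegative; for [s < 0] we
     have [|s| < |t|], which makes [f 0 w] nonpositive. *)
  have [s0|s0] := lerP 0 s.
    by have : 0 <= s * f v w; [apply: mulr_ge0; lra|lra].
  have : f v w <= 0; last lra.
  rewrite /f v_0 !add0r !exprMn -mulrBl pmulr_rle0// mulr_le0_ge0 ?exprn_ge0//.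
  by rewrite subr_le0 (eX s) (eX t) normX// !ler0_norm; lra.
have oddX (x y : R) : x <= y -> x ^+ m <= y ^+ m.
  move=> xy; have [x0|x0] := lerP 0 x.
    by rewrite lerXn2r ?nnegrE ?(le_trans x0).
  have [y0|y0] := lerP 0 y.
    by apply: (@le_trans _ _ 0); [rewrite exprn_odd_le0 ?ltW | apply: exprn_ge0].
  have: (- y) ^+ m <= (- x) ^+ m by rewrite lerXn2r ?nnegrE; lra.
  by rewrite (exprNn x) (exprNn y) -signr_odd om expr1 !mulN1r lerN2.
(* With [t < s], the first case means [|t| <= s]: the first term of [g] dominates, so [w = 0], and
   [f v 0 = 0] contradicts [q1 = -1]. *)
have [st|st] := lerP (- s) t.
  exists (-1), 1 => v w v0 w0 f1 g1 /eqP fv /eqP.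
  have g0 : 0 <= g v w.
    apply: mulr_ge0; [exact: ltW | rewrite subr_ge0].
    apply: le_trans (ler_norm _) _; rewrite normrM normrX.
    have tw : t * w <= s * w by rewrite ler_wpM2r// ltW.
    have sw : - s * w <= t * w by rewrite ler_wpM2r.
    rewrite ler_pM ?exprn_ge0// ?ler_norml; first by apply/andP; lra.
    by apply: normX; rewrite ler_norml; apply/andP; split; lra.
  rewrite mulf_eq0 => /orP[/eqP w_0|/eqP]; last lra.
  by move: f1; rewrite w_0 fw0; lra.
(* Here [|s| < - t]. Odd powers are increasing, so [f >= 0] and [v = 0]; then
   [g 0 w = a (s^(m+1) - t^(m+1)) w^m <= 0] since [m + 1] is even. *)
exists 1, (-1) => v w v0 w0 f1 g1 /eqP fv /eqP gw.
have f0 : 0 <= f v w.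
  apply: mulr_ge0; [exact: ltW | rewrite subr_ge0].
  have tw : v + t * w <= v + s * w by rewrite lerD2l ler_wpM2r// ltW.
  exact: oddX.
have v_0 : v = 0 by move: fv; rewrite mulf_eq0 => /orP[/eqP//|/eqP]; lra.
have : g v w <= 0; last lra.
rewrite /g v_0 !add0r !exprMn !mulrA -mulrBl -!exprS pmulr_rle0//.
rewrite mulr_le0_ge0 ?exprn_ge0// subr_le0.
have eX (x : R) : x ^+ m.+1 = `|x| ^+ m.+1.
  by rewrite -normrX ger0_norm ?exprn_even_ge0//= om.
rewrite (eX s) (eX t) normX// ler_norml.
have := ler_norm (-t); rewrite normrN => ?; apply/andP; split; lra.
Qed.

(** * Planar vectors and their determinants *)

Definition det2 (R : comNzRingType) (p q : 'I_2 -> R) : R :=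
  p 0 * q 1 - p 1 * q 0.

Lemma ord2P (P : 'I_2 -> Prop) : P 0 -> P 1 -> forall i, P i.
Proof.
move=> P0 P1 [[|[|k]] Hk] //.
  by rewrite (_ : Ordinal Hk = 0) //; apply: val_inj.
by rewrite (_ : Ordinal Hk = 1) //; apply: val_inj.
Qed.

Lemma det2_eq0 (R : fieldType) (p q : 'I_2 -> R) (k : 'I_2) :
  p k != 0 -> det2 p q = 0 -> forall i, q i = q k / p k * p i.
Proof.
rewrite /det2 => pk pq i; apply: (mulIf pk).
rewrite mulrAC divfK//; apply/eqP; rewrite -subr_eq0; apply/eqP.
have qp0 : p 0 * q 1 = p 1 * q 0 by apply/eqP; rewrite -subr_eq0 pq.
move: k i {pk}; apply: ord2P; apply: ord2P; first [ring | ring: qp0].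
Qed.

(** * Decompositions into two products *)

(** Scalars are absorbed into the factors, and factors may vanish; degenerate terms are excluded
    afterwards by the rank. *)
Definition two_term (R : realType) (m : nat) (A : tensor R m 2)
    (x y : 'I_m -> 'I_2 -> R) : Prop :=
  forall t, A t = \prod_j x j (tnth t j) + \prod_j y j (tnth t j).

(** A vanishing factor makes the tensor zero, which is a combination of length one with coefficient
    0. Hence the negation of [rank_one_combination A 1] also excludes the zero tensor. *)
Lemma prod_combination1 (R : realType) (m n : nat) (A : tensor R m n.+1)
    (z : 'I_m -> 'I_n.+1 -> R) :
  (forall t, A t = \prod_j z j (tnth t j)) -> rank_one_combination A 1.
Proof.
move=> Az; have [z0|zN0] := boolP [exists j, [forall i, z j i == 0]].
  case/existsP: z0 => j /forallP z0.
  exists (fun=> 0), (fun=> outer_product (fun=> const_mx 1)); split => [_|].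
    exists (fun=> const_mx 1); split=> // _.
    by apply/eqP => /matrixP/(_ 0 0); rewrite !mxE; apply/eqP/oner_neq0.
  apply/ffunP => t; rewrite ffunE big_ord1 mul0r Az (bigD1 j)//= (eqP (z0 _)).
  by rewrite mul0r.
exists (fun=> 1), (fun=> outer_product (fun j => \col_i z j i)); split => [_|].
  exists (fun j => \col_i z j i); split=> // j; apply: contraNneq zN0 => zj.
  apply/existsP; exists j; apply/forallP => i.
  by move/matrixP/(_ i 0): zj; rewrite !mxE => ->.
apply/ffunP => t; rewrite ffunE big_ord1 mul1r Az ffunE.
by apply: eq_bigr => j _; rewrite mxE.
Qed.

Lemma combination2_two_term (R : realType) (m : nat) (A : tensor R m.+1 2) :
  rank_one_combination A 2 -> exists x y, two_term A x y.
Proof.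
case=> c [T [T1 ->]].
have [z Tz] : exists z : 'I_2 -> 'I_m.+1 -> 'I_2 -> R,
    forall k t, c k * T k t = \prod_j z k j (tnth t j).
  have H k : exists z : 'I_m.+1 -> 'I_2 -> R,
      forall t, c k * T k t = \prod_j z j (tnth t j).
    have [x [_ ->]] := T1 k.
    (* The coefficient goes into slot 0, which exists because the order is [m.+1]. *)
    exists (fun j i => (if j == 0 then c k else 1) * x j i 0) => t.
    rewrite ffunE !big_ord_recl /= mulrA; congr (_ * _).
    by apply: eq_bigr => j _; rewrite mul1r.
  have [z0 z0E] := H 0; have [z1 z1E] := H 1.
  by exists (fun k => if k == 0 then z0 else z1); apply: ord2P.
exists (z 0), (z 1) => t; rewrite ffunE big_ord_recl big_ord1.
have -> : lift ord0 ord0 = 1 :> 'I_2 by apply: val_inj.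
by rewrite !Tz.
Qed.

Lemma two_termC (R : realType) (m : nat) (A : tensor R m 2) x y :
  two_term A x y -> two_term A y x.
Proof. by move=> Axy t; rewrite Axy addrC. Qed.

Lemma two_term_neq0 (R : realType) (m : nat) (A : tensor R m 2) x y :
  two_term A x y -> ~ rank_one_combination A 1 ->
  forall j, exists k, x j k != 0.
Proof.
move=> Axy A1 j; apply/existsP; apply: contra_notT A1 => xj.
apply: (@prod_combination1 _ _ _ _ y) => t.
rewrite Axy (bigD1 j)//=; move: xj; rewrite negb_exists => /forallP/(_ (tnth t j)).
by rewrite negbK => /eqP->; rewrite mul0r add0r.
Qed.

(* If x and y are parallel in all slots but k, the two products can be
   merged by adding the vectors in slot k. *)
Lemma two_term_det (R : realType) (m : nat) (A : tensor R m 2) x y :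
  two_term A x y -> ~ rank_one_combination A 1 ->
  forall k, exists2 l, l != k & det2 (x l) (y l) != 0.
Proof.
move=> Axy A1 k; apply/exists_inP; apply: contraT => H; case: (A1).
have parl l : l != k -> det2 (x l) (y l) = 0.
  move=> lk; apply/eqP; move: H; rewrite negb_exists => /forallP/(_ l).
  by rewrite negb_and lk negbK.
have [c yc] : exists c : 'I_m -> R,
    forall l, l != k -> forall i, y l i = c l * x l i.
  pose e l := xchoose (two_term_neq0 Axy A1 l).
  exists (fun l => y l (e l) / x l (e l)) => l lk i.
  by rewrite -det2_eq0 ?parl //; apply: xchooseP (two_term_neq0 Axy A1 l).
pose z j i := if j == k then x k i + \prod_(l | l != k) c l * y k i else x j i.
apply: (@prod_combination1 _ _ _ _ z) => t.
have prodD (w : 'I_m -> 'I_2 -> R) : \prod_j w j (tnth t j) =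
    w k (tnth t k) * \prod_(j | j != k) w j (tnth t j) by rewrite (bigD1 k).
rewrite Axy !prodD /z eqxx mulrDl.
have -> : \prod_(i | i != k) (if i == k then x k (tnth t i) +
    \prod_(l | l != k) c l * y k (tnth t i) else x i (tnth t i))
  = \prod_(i | i != k) x i (tnth t i).
  by apply: eq_bigr => l /negbTE ->.
congr (_ + _).
rewrite (eq_bigr (fun l => c l * x l (tnth t l))) => [|l lk]; last exact: yc.
by rewrite big_split /=; ring.
Qed.

(** * Symmetry forces parallel factors *)

(* Contract slots j and k of A with the alternating form. *)
Lemma two_term_swap (R : realType) (m : nat) (A : tensor R m 2) x y
    (j k : 'I_m) (p : 'I_m -> 'I_2) :
  symmetric_tensor A -> two_term A x y -> j != k ->
  det2 (x j) (x k) * \prod_(l | (l != j) && (l != k)) x l (p l)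
  + det2 (y j) (y k) * \prod_(l | (l != j) && (l != k)) y l (p l) = 0.
Proof.
move=> symA Axy jk.
have kj : (k == j) = false by rewrite eq_sym (negbTE jk).
pose t a b : m.-tuple 'I_2 :=
  [tuple if l == j then a else if l == k then b else p l | l < m].
have prodE (z : 'I_m -> 'I_2 -> R) a b : \prod_l z l (tnth (t a b) l) =
    z j a * (z k b * \prod_(l | (l != j) && (l != k)) z l (p l)).
  rewrite (bigD1 j)//= (bigD1 k) 1?eq_sym//= !tnth_mktuple !eqxx.
  rewrite kj; congr (_ * (_ * _)).
  by apply: eq_bigr => l /andP[/negbTE lj /negbTE lk]; rewrite tnth_mktuple lj lk.
have : A (t 0 1) = A (t 1 0).
  rewrite -(symA (tperm j k) (t 0 1)); congr (A _).
  apply: eq_from_tnth => l; rewrite !tnth_mktuple.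
  case: tpermP => [->|->|/eqP/negbTE lj /eqP/negbTE lk].
  - by rewrite !eqxx kj.
  - by rewrite !eqxx kj.
  - by rewrite lj lk.
rewrite !Axy !prodE /det2 => /eqP; rewrite -subr_eq0 => /eqP E.
by rewrite -[RHS]E; ring.
Qed.

(** With the index of slot [l] left free, the swap identity is a linear relation between [x l] and
    [y l] whose coefficient at [x l] is nonzero. *)
Lemma two_term_swap_parallel (R : realType) (m : nat) (A : tensor R m 2) x y
    (j k l : 'I_m) :
  symmetric_tensor A -> two_term A x y -> ~ rank_one_combination A 1 ->
  j != k -> det2 (x j) (x k) != 0 -> l != j -> l != k ->
  det2 (x l) (y l) = 0.
Proof.
move=> symA Axy A1 jk djk lj lk.
pose e l := xchoose (two_term_neq0 Axy A1 l).
(* The other slots are evaluated at coordinates [e h] where [x h] does not vanish, so [P x] is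
   nonzero; nothing is claimed about [P y]. *)
pose P (z : 'I_m -> 'I_2 -> R) :=
  \prod_(h | [&& h != j, h != k & h != l]) z h (e h).
have E i : det2 (x j) (x k) * (x l i * P x) +
    det2 (y j) (y k) * (y l i * P y) = 0.
  pose p h := if h == l then i else e h.
  rewrite -[RHS](@two_term_swap _ _ A x y j k p)//.
  have PE z : \prod_(h | (h != j) && (h != k)) z h (p h)
     = z l i * P z.
    rewrite /p (bigD1 l) /= ?lj ?lk// eqxx; congr (_ * _).
    by apply: eq_big => [h|h /andP[_ /negbTE ->]//]; rewrite andbA.
  by rewrite !PE.
have Px : P x != 0.
  by apply/prodf_neq0 => h _; apply: xchooseP (two_term_neq0 Axy A1 h).
apply: (mulfI (mulf_neq0 djk Px)); rewrite mulr0 [det2 (x l) _]/det2.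
transitivity (
  (det2 (x j) (x k) * (x l 0 * P x) + det2 (y j) (y k) * (y l 0 * P y)) * y l 1 -
  (det2 (x j) (x k) * (x l 1 * P x) + det2 (y j) (y k) * (y l 1 * P y)) * y l 0).
  by ring.
by rewrite !E !mul0r subrr.
Qed.

Lemma det2_trans (R : fieldType) (p q r : 'I_2 -> R) (k : 'I_2) :
  q k != 0 -> det2 q p = 0 -> det2 q r = 0 -> det2 p r = 0.
Proof.
move=> qk qp qr; have pE := det2_eq0 qk qp; have rE := det2_eq0 qk qr.
by rewrite /det2 (pE 0) (pE 1) (rE 0) (rE 1); ring.
Qed.

(** Suppose [x j] and [x k] are independent. Then [x] and [y] are parallel in all other slots, so by
    [two_term_det] they are independent in slots [j] and [k]. For a third slot [l], independence of
    [x l] from [x j] would make slot [k] parallel, and likewise with [j] and [k] exchanged. So [x l]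
    is parallel to both, a contradiction. *)
Lemma two_term_parallel (R : realType) (m : nat) (A : tensor R m 2) x y :
  (2 < m)%N ->
  symmetric_tensor A -> two_term A x y -> ~ rank_one_combination A 1 ->
  forall j k, det2 (x j) (x k) = 0.
Proof.
move=> m2 symA Axy A1 j k; apply/eqP/contraT => djk.
have jk : j != k.
  by apply: contra_neq djk => ->; rewrite /det2 mulrC subrr.
have [l /andP[lj lk]] : exists l : 'I_m, (l != j) && (l != k).
  have /card_gt0P[l] : (0 < #|~: [set j; k]|)%N.
    by rewrite cardsCs setCK card_ord cards2 jk subn_gt0.
  by rewrite !inE negb_or => ?; exists l.
have par h : h != j -> h != k -> det2 (x h) (y h) = 0.
  by apply: two_term_swap_parallel symA Axy A1 jk djk.
have nparj : det2 (x j) (y j) != 0.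
  have [g gk gN0] := two_term_det Axy A1 k.
  have [<-//|gj] := eqVneq g j; by rewrite par ?eqxx in gN0.
have npark : det2 (x k) (y k) != 0.
  have [g gj gN0] := two_term_det Axy A1 j.
  have [<-//|gk] := eqVneq g k; by rewrite par ?eqxx in gN0.
have lj0 : det2 (x l) (x j) = 0.
  apply/eqP; apply: contraT => dlj; move: npark.
  by rewrite (two_term_swap_parallel symA Axy A1 lj dlj) ?eqxx// eq_sym.
have lk0 : det2 (x l) (x k) = 0.
  apply/eqP; apply: contraT => dlk; move: nparj.
  by rewrite (two_term_swap_parallel symA Axy A1 lk dlk) ?eqxx// eq_sym.
have [i xli] := two_term_neq0 Axy A1 l.
by rewrite (det2_trans xli lj0 lk0) eqxx in djk.
Qed.

(** Every factor is a multiple of the one in slot 0; [a] and [b] collect the multipliers. Some slot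
    has independent factors, so those of slot 0 are independent. *)
Lemma two_term_power (R : realType) (m : nat) (A : tensor R m.+1 2) x y :
  (1 < m)%N ->
  symmetric_tensor A -> two_term A x y -> ~ rank_one_combination A 1 ->
  exists a b p q, det2 p q != 0 /\
    forall t, A t = a * \prod_j p (tnth t j) + b * \prod_j q (tnth t j).
Proof.
move=> m1 symA Axy A1.
have pow z w : two_term A z w -> exists c : 'I_m.+1 -> R,
    forall j i, z j i = c j * z 0 i.
  move=> Azw; have [k zk] := two_term_neq0 Azw A1 0.
  exists (fun j => z j k / z 0 k) => j i.
  by apply: det2_eq0 => //; apply: two_term_parallel symA Azw A1 _ _.
have [c xc] := pow _ _ Axy; have [d yd] := pow _ _ (two_termC Axy).
exists (\prod_j c j), (\prod_j d j), (x 0), (y 0); split=> [|t].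
  have [l _] := two_term_det Axy A1 0.
  apply: contra_neq => xy0; rewrite /det2 !(xc l) !(yd l).
  by transitivity (c l * d l * det2 (x 0) (y 0));
    [rewrite /det2; ring | rewrite xy0 mulr0].
by rewrite Axy -!big_split; congr (_ + _); apply: eq_bigr.
Qed.

(** * Evaluation through linear forms *)

(** Expanding each product of linear forms over all choices of indices gives the sum over tuples
    that defines [tensor_apply]. *)
Lemma tensor_apply_two_term (R : realType) (m : nat) (A : tensor R m.+1 2)
    (x y : 'I_m.+1 -> 'I_2 -> R) (a b : R) (u : 'cV[R]_2) i :
  (forall t, A t = a * \prod_j x j (tnth t j) + b * \prod_j y j (tnth t j)) ->
  tensor_apply A u i 0 =
    a * (x 0 i * \prod_(j < m) \sum_k x (lift ord0 j) k * u k 0) +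
    b * (y 0 i * \prod_(j < m) \sum_k y (lift ord0 j) k * u k 0).
Proof.
move=> Axy; rewrite mxE.
have E (z : 'I_m.+1 -> 'I_2 -> R) :
    z 0 i * \prod_(j < m) \sum_k z (lift ord0 j) k * u k 0 =
    \sum_(t : m.-tuple 'I_2)
      \prod_j z j (tnth [tuple of i :: t] j) * \prod_(j < m) u (tnth t j) 0.
  rewrite bigA_distr_bigA big_distrr/=.
  rewrite (reindex (fun t : m.-tuple 'I_2 => [ffun j => tnth t j]))/=.
    apply: eq_bigr => t _; rewrite big_ord_recl -mulrA -big_split/=.
    congr (_ * _); apply: eq_bigr => j _; rewrite ffunE.
    by rewrite tnthS.
  exists (fun f : {ffun 'I_m -> 'I_2} => [tuple f j | j < m]) => t _.
    by apply: eq_from_tnth => j; rewrite tnth_mktuple ffunE.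
  by apply/ffunP => j; rewrite ffunE tnth_mktuple.
rewrite !E !big_distrr -big_split/=; apply: eq_bigr => t _.
by rewrite Axy; ring.
Qed.

Lemma sum_ord2 (V : nmodType) (i j : 'I_2) (f : 'I_2 -> V) :
  i != j -> \sum_k f k = f i + f j.
Proof.
rewrite big_ord_recl big_ord1 (_ : lift _ _ = 1 :> 'I_2); last exact: val_inj.
move: i j; apply: ord2P; apply: ord2P => //= _.
by rewrite addrC.
Qed.

Lemma det2_neq0 (R : comNzRingType) (p q : 'I_2 -> R) (i j : 'I_2) :
  det2 p q != 0 -> i != j -> p i * q j - p j * q i != 0.
Proof.
move=> pq; move: i j; apply: ord2P; apply: ord2P => // _.
by rewrite -opprB oppr_eq0.
Qed.

Lemma cramer0 (R : fieldType) (a b c d x y : R) :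
  a * d - b * c != 0 -> a * x + b * y = 0 -> c * x + d * y = 0 ->
  x = 0 /\ y = 0.
Proof.
move=> D E1 E2; split; apply: (mulfI D); rewrite mulr0.
  by transitivity (d * (a * x + b * y) - b * (c * x + d * y));
    [ring | rewrite E1 E2 !mulr0 subrr].
by transitivity (a * (c * x + d * y) - c * (a * x + b * y));
  [ring | rewrite E1 E2 !mulr0 subrr].
Qed.

(** * Complementarity and the edges of the quadrant *)

(** The inner product is a sum of nonnegative terms, so each term vanishes with it. *)
Lemma TCP_complementary (R : realType) (m n : nat) (A : tensor R m.+1 n) q u :
  TCP_solution A q u -> forall i, u i 0 * (tensor_apply A u + q) i 0 = 0.
Proof.
case=> u0 Au0 /matrixP/(_ 0 0); rewrite [LHS]mxE [RHS]mxE => uAu i.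
have /psumr_eq0P := uAu; move=> /(_ _ i isT); rewrite mxE; apply => k _.
by rewrite mxE mulr_ge0.
Qed.

(** With [v = u i 0] and [w = u j 0], this is the gradient of the binary form
    [a ((v + s w)^(m+1) - (v + t w)^(m+1))], divided by [m + 1]. *)
Definition power_difference (R : realType) (m : nat) (A : tensor R m.+1 2)
    (i j : 'I_2) (a s t : R) : Prop :=
  forall u : 'cV[R]_2,
    tensor_apply A u i 0 =
      a * ((u i 0 + s * u j 0) ^+ m - (u i 0 + t * u j 0) ^+ m) /\
    tensor_apply A u j 0 =
      a * (s * (u i 0 + s * u j 0) ^+ m - t * (u i 0 + t * u j 0) ^+ m).

Lemma power_difference_not_Q (R : realType) (m : nat) (A : tensor R m.+1 2)
    (i j : 'I_2) (a s t : R) :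
  i != j -> 0 < a * (s - t) -> power_difference A i j a s t -> ~ Q_tensor A.
Proof.
(* Replacing [(a, s, t)] by [(- a, t, s)] changes neither the map nor [a * (s - t)]. *)
move=> ij; wlog a0 : a s t / 0 < a => [H ast F|].
  have [a0|a0|a0] := ltrgtP a 0.
  - apply: (H (- a) t s); rewrite ?oppr_gt0//.
      by rewrite (_ : _ * _ = a * (s - t)) //; ring.
    by move=> u; have [-> ->] := F u; split; ring.
  - exact: (H a s t).
  - by rewrite a0 mul0r ltxx in ast.
rewrite pmulr_rgt0// subr_gt0 => ts F QA.
have [q1 [q2 H]] := planar_unsolvable m a0 ts.
have [u uS] := QA (\col_k if k == i then q1 else q2).
have uC := TCP_complementary uS; case: uS => u0 Au0 _.
have [Fi Fj] := F u; apply: (H _ _ (u0 i) (u0 j)).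
- by move: (Au0 i); rewrite !mxE eqxx -Fi mxE.
- by move: (Au0 j); rewrite !mxE eq_sym (negbTE ij) -Fj mxE.
- by move: (uC i); rewrite !mxE eqxx -Fi mxE.
- by move: (uC j); rewrite !mxE eq_sym (negbTE ij) -Fj mxE.
Qed.

(* A nonzero solution of TCP(A, 0) lies on an edge of the quadrant, since
   A u^m vanishes at interior solutions. *)
Lemma Q_tensor_R0 (R : realType) (m : nat) (A : tensor R m.+1 2) :
  (forall u, tensor_apply A u = 0 <-> u = 0) ->
  (forall (i j : 'I_2) (u : 'cV[R]_2), i != j -> 0 < u i 0 -> u j 0 = 0 ->
     tensor_apply A u i 0 = 0 -> 0 < tensor_apply A u j 0 ->
     exists a s t, 0 < a * (s - t) /\ power_difference A i j a s t) ->
  Q_tensor A -> R0_tensor A.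
Proof.
move=> A0 edge QA u; split=> [uS|->]; last first.
  have A00 : tensor_apply A 0 = 0 by apply/A0.
  split; rewrite ?A00 ?addr0 ?mulmx0// => i; rewrite ?A00 mxE//.
have uC := TCP_complementary uS; case: uS; rewrite addr0 in uC * => u0 Au0 _.
(* On an edge, complementarity kills component [i] of [A u^m]; component [j] must then be positive,
   as otherwise [A u^m = 0] and [u = 0]. *)
have edgeF i j : i != j -> 0 < u i 0 -> u j 0 = 0 -> False.
  move=> ij ui uj.
  have Fi : tensor_apply A u i 0 = 0.
    by have /eqP := uC i; rewrite mulf_eq0 (gt_eqF ui) => /eqP.
  have Fj : 0 < tensor_apply A u j 0.
    rewrite lt_neqAle Au0 andbT eq_sym; apply/eqP => Fj.
    have /A0 u_0 : tensor_apply A u = 0.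
      apply/matrixP => k l; rewrite (ord1 l) [RHS]mxE.
      move: i j ij {ui uj} Fi Fj k.
      by apply: ord2P; apply: ord2P => // _ Fi Fj; apply: ord2P.
    by move: ui; rewrite u_0 mxE ltxx.
  have [a [s [t [ast F]]]] := edge i j u ij ui uj Fi Fj.
  exact: power_difference_not_Q ij ast F QA.
have uP i : u i 0 = 0 \/ 0 < u i 0.
  by have := u0 i; rewrite le_eqVlt => /orP[/eqP|]; [left|right].
have [v0|v0] := uP 0; have [v1|v1] := uP 1.
- by apply/matrixP => k l; rewrite (ord1 l) [RHS]mxE; move: k; apply: ord2P.
- by case: (edgeF 1 0).
- by case: (edgeF 0 1).
apply/A0/matrixP => k l; rewrite (ord1 l) [RHS]mxE.
have /eqP := uC k; rewrite mulf_eq0 => /orP[/eqP uk|/eqP//].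
by move: k uk; apply: ord2P => uk; move: v0 v1; rewrite uk ltxx.
Qed.

(** * Orders one, two and at least three *)

(** At order 1 the vector [tensor_apply A u] does not depend on [u], so a suitable [q] makes the
    slack constantly -1. *)
Lemma order1_not_Q (R : realType) (n : nat) (A : tensor R 1 n.+1) :
  ~ Q_tensor A.
Proof.
move=> QA; have [u [_ /(_ 0) + _]] := QA (- tensor_apply A 0 - const_mx 1).
have -> : tensor_apply A u = tensor_apply A 0.
  by apply/matrixP => i j; rewrite !mxE; apply: eq_bigr => t _; rewrite !big_ord0.
by rewrite addrA subrr add0r !mxE oppr_ge0 ler10.
Qed.

(** The matrix [M] of [A] is invertible because the factors are independent in both slots. An edge
    solution forces [M i i = 0] and [M i j > 0]. *)
Lemma matrix_R0 (R : realType) (A : tensor R 2 2) x y :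
  symmetric_tensor A -> two_term A x y -> ~ rank_one_combination A 1 ->
  Q_tensor A -> R0_tensor A.
Proof.
move=> symA Axy A1.
have d0 : det2 (x 0) (y 0) != 0.
  have [l] := two_term_det Axy A1 1.
  by move: l; apply: ord2P.
have d1 : det2 (x 1) (y 1) != 0.
  have [l] := two_term_det Axy A1 0.
  by move: l; apply: ord2P.
pose M i k := x 0 i * x 1 k + y 0 i * y 1 k.
have MC i j : M i j = M j i.
  have := @two_term_swap _ _ A x y 0 1 (fun=> 0) symA Axy isT.
  rewrite !big1 ?mulr1 => [E|l|l]; last 2 first.
  - by move: l; apply: ord2P.
  - by move: l; apply: ord2P.
  rewrite /M; move: E; rewrite /det2 => E.
  suff : x 0 0 * x 1 1 + y 0 0 * y 1 1 = x 0 1 * x 1 0 + y 0 1 * y 1 0.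
    by move: i j; apply: ord2P; apply: ord2P.
  by apply/eqP; rewrite -subr_eq0 -[X in _ == X]E; apply/eqP; ring.
have FE u i : tensor_apply A u i 0 =
    x 0 i * (\sum_k x 1 k * u k 0) + y 0 i * (\sum_k y 1 k * u k 0).
  rewrite (@tensor_apply_two_term _ _ A x y 1 1) => [|t]; last by rewrite !mul1r.
  rewrite !big_ord1 !mul1r (_ : lift ord0 ord0 = 1 :> 'I_2)//.
  exact: val_inj.
have FM u i k j : k != j -> tensor_apply A u i 0 = M i k * u k 0 + M i j * u j 0.
  by move=> kj; rewrite FE !(sum_ord2 _ kj) /M; ring.
apply: Q_tensor_R0 => [u|i j u ij ui uj Fi Fj].
  split=> [Au0|->]; last first.
    by apply/matrixP => k l; rewrite (ord1 l) (@FM _ k 0 1)// !mxE !mulr0 addr0.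
  have E i : x 0 i * (\sum_k x 1 k * u k 0) + y 0 i * (\sum_k y 1 k * u k 0) = 0.
    by rewrite -FE Au0 mxE.
  have [] := cramer0 _ (E 0) (E 1).
    by rewrite [X in _ - X]mulrC.
  rewrite !(@sum_ord2 _ 0 1)// => Ex Ey.
  have [u0 u1] := cramer0 (d1 : _ - _ != 0) Ex Ey.
  by apply/matrixP => k l; rewrite (ord1 l) [RHS]mxE; move: k; apply: ord2P.
have Mii : M i i = 0.
  move: Fi; rewrite (FM _ _ _ _ ij) uj mulr0 addr0 => /eqP.
  by rewrite mulf_eq0 (gt_eqF ui) orbF => /eqP.
have b0 : 0 < M i j.
  by move: Fj; rewrite (FM _ _ _ _ ij) uj mulr0 addr0 pmulr_lgt0// MC.
(* 2bvw + cw^2 as a difference of two squares *)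
exists (M i j ^+ 2), ((M j j + 1) / (2 * M i j)), ((M j j - 1) / (2 * M i j)).
have bN0 : M i j != 0 by rewrite gt_eqF.
split; first by rewrite [X in 0 < X](_ : _ = M i j)//; field.
move=> v; rewrite !(FM _ _ _ _ ij) Mii (MC j i).
by split; field.
Qed.

(** An edge solution gives [a p_i^(m+1) = - b q_i^(m+1)]. Rescaling [p] and [q] to have [i]-th
    coordinate 1 therefore produces opposite coefficients, that is, a power difference. *)
Lemma power_sum_R0 (R : realType) (m : nat) (A : tensor R m.+1 2) a b p q :
  (0 < m)%N -> ~ rank_one_combination A 1 -> det2 p q != 0 ->
  (forall t, A t = a * \prod_j p (tnth t j) + b * \prod_j q (tnth t j)) ->
  Q_tensor A -> R0_tensor A.
Proof.
move=> m0 A1 pq Apq.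
have rank1 c (z : 'I_2 -> R) : ~ (forall t, A t = c * \prod_j z (tnth t j)).
  move=> Ac; apply: A1.
  pose w (j : 'I_m.+1) i := (if j == 0 then c else 1) * z i.
  apply: (@prod_combination1 _ _ _ _ w) => t.
  rewrite Ac /w !big_ord_recl/= mulrA; congr (_ * _).
  by apply: eq_bigr => j _; rewrite mul1r.
have a0 : a != 0.
  by apply/eqP => a_0; apply: (rank1 b q) => t; rewrite Apq a_0 mul0r add0r.
have b0 : b != 0.
  by apply/eqP => b_0; apply: (rank1 a p) => t; rewrite Apq b_0 mul0r addr0.
have FE u i : tensor_apply A u i 0 =
    a * p i * (\sum_k p k * u k 0) ^+ m + b * q i * (\sum_k q k * u k 0) ^+ m.
  rewrite (tensor_apply_two_term (x := fun=> p) (y := fun=> q) _ _ Apq).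
  by rewrite !prodr_const card_ord !mulrA.
apply: Q_tensor_R0 => [u|i j u ij ui uj].
  split=> [Au0|->]; last first.
    apply/matrixP => k l; rewrite (ord1 l) FE !(@sum_ord2 _ 0 1)// !mxE !mulr0.
    by rewrite addr0 expr0n (gtn_eqF m0) !mulr0 addr0.
  (* Cramer is applied twice: first to the weighted powers of the two linear forms, then to the
     forms themselves. *)
  have E i : p i * (a * (\sum_k p k * u k 0) ^+ m) +
             q i * (b * (\sum_k q k * u k 0) ^+ m) = 0.
    by rewrite -[RHS](_ : tensor_apply A u i 0 = 0) ?FE; [ring | rewrite -FE Au0 mxE].
  have [|/eqP + /eqP] := cramer0 _ (E 0) (E 1).
    by rewrite [X in _ - X]mulrC.
  rewrite !mulf_eq0 (negbTE a0) (negbTE b0) !expf_eq0 m0 /= => /eqP Ep /eqP Eq.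
  rewrite !(@sum_ord2 _ 0 1)// in Ep Eq.
  have [u0 u1] := cramer0 (pq : _ - _ != 0) Ep Eq.
  by apply/matrixP => k l; rewrite (ord1 l) [RHS]mxE; move: k; apply: ord2P.
rewrite !FE !(sum_ord2 _ ij) uj !mulr0 !addr0 !exprMn => Fi Fj.
have Ei : a * p i ^+ m.+1 = - (b * q i ^+ m.+1).
  apply/eqP; rewrite -addr_eq0; apply/eqP.
  have uim : u i 0 ^+ m != 0 by rewrite expf_neq0// gt_eqF.
  by apply: (mulIf uim); rewrite mul0r -[RHS]Fi !exprS; ring.
have Ej : 0 < a * p j * p i ^+ m + b * q j * q i ^+ m.
  have uim : 0 < u i 0 ^+ m by rewrite exprn_gt0.
  by rewrite -(pmulr_lgt0 _ uim); move: Fj; rewrite !mulrA mulrDl.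
have dij := det2_neq0 pq ij.
have pi0 : p i != 0.
  apply/eqP => p_0; move/eqP: Ei; rewrite p_0 expr0n mulr0 eq_sym oppr_eq0.
  rewrite mulf_eq0 (negbTE b0) expf_eq0 /= => /eqP q_0.
  by rewrite p_0 q_0 mul0r mulr0 subrr eqxx in dij.
have qi0 : q i != 0.
  apply/eqP => q_0; move/eqP: Ei; rewrite q_0 expr0n mulr0 oppr0.
  rewrite mulf_eq0 (negbTE a0) expf_eq0 /= => /eqP p_0.
  by rewrite p_0 q_0 mul0r mulr0 subrr eqxx in dij.
have scale (r : 'I_2 -> R) v w : r i != 0 ->
    r i ^+ m.+1 * (v + r j / r i * w) ^+ m = r i * (r i * v + r j * w) ^+ m.
  move=> ri; rewrite exprS -mulrA -exprMn mulrDr; congr (_ * (_ + _) ^+ _).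
  by field.
have diff (c d : R) : a * p i ^+ m.+1 * (c - d) =
    a * (p i ^+ m.+1 * c) + b * (q i ^+ m.+1 * d).
  by rewrite mulrBr {2}Ei; ring.
(* The slopes are those of the rescaled [p] and [q]; [a * (s - t)] becomes the left factor in [Ej],
   which is component [j] of [A u^m] divided by [u_i^m]. *)
exists (a * p i ^+ m.+1), (p j / p i), (q j / q i); split.
  rewrite diff (_ : _ + _ = a * p j * p i ^+ m + b * q j * q i ^+ m)//.
  by rewrite !exprS; field; apply/andP.
move=> v; rewrite !FE !(sum_ord2 _ ij) !diff.
rewrite (mulrCA (p i ^+ m.+1)) (mulrCA (q i ^+ m.+1)) !scale//.
by split; [ring | field; apply/andP].
Qed.

Theorem corollary2 (R : realType) (m : nat) (A : tensor R m.+1 2)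
  (symA : symmetric_tensor A) (rankA : has_tensor_rank A 2)
  (QA : Q_tensor A) : R0_tensor A.
Proof.
case: rankA => /combination2_two_term[x [y Axy]] minA.
(* Minimality of the rank enters only as the absence of a combination of length one. *)
have A1 : ~ rank_one_combination A 1 by move/minA.
case: m => [|[|m]] in A symA QA x y Axy minA A1 *.
- by case: (order1_not_Q QA).
- exact: matrix_R0 symA Axy A1 QA.
have [//|a [b [p [q [pq Apq]]]]] := two_term_power _ symA Axy A1.
exact: power_sum_R0 A1 pq Apq QA.
Qed.
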